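(* Let $H$ be a Hilbert space, let $C\subset H$ be nonempty, closed, bounded and convex, and let $F:C\times C\to C$ be a weakly nonexpansive mapping such that $\{q\in C: F(q,q)=q\}=\{p\}$ for some $p\in C$. Then, for every $\lambda\in(0,1)$ and every $x_0\in C$, the sequence $\{x_n\}_{n\ge 0}$ defined by $$x_{n+1}=(1-\lambda)x_n+\lambda F(x_n,x_n),\quad n\ge 0,$$ converges weakly to $p$.
   Context: A mapping $F:C\times C\to H$, with $C$ a subset of a normed linear space $H$, is called weakly nonexpansive if there are constants $a,b\ge 0$ with $a+b\le 1$ such that $\|F(x,y)-F(u,v)\|\le a\|x-u\|+b\|y-v\|$ for all $x,y,u,v\in C$. *)

(* Defs.v *)
From HB Require Import structures.
From mathcomp Require Import all_boot all_order all_algebra.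
From mathcomp Require Import sesquilinear complex.
From mathcomp Require Import all_classical all_reals.
From mathcomp Require Import topology normedtype convex sequences.

Set Implicit Arguments.
Unset Strict Implicit.
Unset Printing Implicit Defensive.

Import Order.TTheory GRing.Theory Num.Theory.
Import numFieldNormedType.Exports.

Local Open Scope classical_set_scope.
Local Open Scope ring_scope.

(* Hilbert spaces are taken over the real numbers or over the complex numbers;
   [R] is an arbitrary model of the real numbers. *)
Inductive scalar_kind := real_scalars | complex_scalars.

Definition scalarField (R : realType) (k : scalar_kind) : numFieldType :=
  match k with
  | real_scalars => R
  | complex_scalars => R[i]
  end.

Definition scalar_conj (R : realType) (k : scalar_kind) :
    {rmorphism scalarField R k -> scalarField R k} :=
  match k with
  | real_scalars => idfun
  | complex_scalars => @conjc R
  end.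

(* The inner product is linear in its first argument, conjugate-linear in the
   second one, hermitian and positive definite. *)
Record hilbertSpace (R : realType) (k : scalar_kind) := HilbertSpace {
  hilbert_sort :> completeNormedModType (scalarField R k) ;
  inner : {dot hilbert_sort for scalar_conj R k} ;
  inner_normE : forall x : hilbert_sort, inner x x = `|x| ^+ 2
}.

(* In the partially ordered field [R[i]], [0 <= a] entails that [a] is real,
   so that [a] and [b] are real numbers for both kinds of scalars; the values
   of [F] outside [C] are irrelevant. *)
Definition weakly_nonexpansive (K : numFieldType) (V : normedModType K)
    (C : set V) (F : V -> V -> V) : Prop :=
  exists a b : K, [/\ 0 <= a, 0 <= b, a + b <= 1 &
    forall x y u v : V, C x -> C y -> C u -> C v ->
      `|F x y - F u v| <= a * `|x - u| + b * `|y - v|].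

Definition weak_cvg (K : numFieldType) (V : normedModType K)
    (u : nat -> V) (l : V) : Prop :=
  forall f : {linear V -> K^o}, continuous f ->
    (fun n => f (u n)) @ \oo --> f l.

(* Main.v *)
Require Import Defs.
From HB Require Import structures.
From mathcomp Require Import all_boot all_order all_algebra.
From mathcomp Require Import sesquilinear complex.
From mathcomp Require Import all_classical all_reals.
From mathcomp Require Import topology normedtype convex sequences.
From mathcomp Require Import interval_inference ring lra.

Import Order.TTheory GRing.Theory Num.Theory.
Import numFieldNormedType.Exports.

Local Open Scope classical_set_scope.
Local Open Scope ring_scope.

(* T y = F(y,y) is nonexpansive on C and p is its only fixed point. The identity
   |(1-l)v + lw|^2 = (1-l)|v|^2 + l|w|^2 - l(1-l)|v-w|^2 with v = x_n - p and
   w = T x_n - p shows that |x_n - p| decreases and that x_n - T x_n tends to 0.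
   Along any ultrafilter U refining the cofinite one, the bounded functions
   n |-> Re <x_n, h> converge, and by Riesz their limit is Re <z, h> for some z.
   As C is closed and convex, z lies in C, and by the demiclosedness of id - T
   it is a fixed point, so z = p. Hence f(x_n) tends to f(p) along every such U,
   which is convergence of the sequence itself. Both kinds of scalars are treated
   at once by viewing H as a real space with inner product Re <x, y>. *)

(** * Real parts and real scalars inside both scalar fields *)

Section RealScalars.
Context {R : realType}.

Definition re (k : scalar_kind) : scalarField R k -> R :=
  match k with real_scalars => id | complex_scalars => @complex.Re R end.

Definition of_real (k : scalar_kind) : R -> scalarField R k :=
  match k with real_scalars => id | complex_scalars => @real_complex R end.

Arguments re {k}.
Arguments of_real {k}.

Context {k : scalar_kind}.
Local Notation K := (scalarField R k).

Lemma reD (a b : K) : re (a + b) = re a + re b.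
Proof. by case: k a b => //= -[? ?] [? ?]. Qed.

Lemma reN (a : K) : re (- a) = - re a.
Proof. by case: k a => //= -[? ?]. Qed.

Lemma re_of_realM (t : R) (a : K) : re (of_real t * a) = t * re a.
Proof. by case: k a => //= -[x y] /=; rewrite mul0r subr0. Qed.

Lemma re_conj (a : K) : re (scalar_conj R k a) = re a.
Proof. by case: k a => //= -[x y]. Qed.

Lemma of_realK (t : R) : re (of_real t : K) = t.
Proof. by case: k. Qed.

Lemma of_realD (s t : R) : of_real (s + t) = of_real s + of_real t :> K.
Proof. by case: k => //=; rewrite rmorphD. Qed.

Lemma of_realN (t : R) : of_real (- t) = - of_real t :> K.
Proof. by case: k => //=; rewrite rmorphN. Qed.

Lemma of_realM (s t : R) : of_real (s * t) = of_real s * of_real t :> K.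
Proof. by case: k => //=; rewrite rmorphM. Qed.

Lemma of_real0 : of_real 0 = 0 :> K. Proof. by case: k. Qed.

Lemma of_real1 : of_real 1 = 1 :> K. Proof. by case: k. Qed.

Lemma ler_of_real (s t : R) : (of_real s <= of_real t :> K) = (s <= t).
Proof. by case: k => //=; rewrite lecR. Qed.

Lemma ltr_of_real (s t : R) : (of_real s < of_real t :> K) = (s < t).
Proof. by case: k => //=; rewrite ltcR. Qed.

Lemma of_real_gt0 (t : R) : 0 < t -> 0 < of_real t :> K.
Proof. by rewrite -of_real0 ltr_of_real. Qed.

Lemma real_of_real (a : K) : a \is Num.real -> of_real (re a) = a.
Proof. by case: k a => //= a /RRe_real. Qed.

Lemma ge0_of_real (a : K) : 0 <= a -> a = of_real (re a).
Proof. by move=> a0; rewrite real_of_real // ger0_real. Qed.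

(** Positivity forces a scalar to be real for both kinds, so every tolerance, and the step size, can
    be moved to [R]. *)
Lemma gt0_of_real (a : K) : 0 < a ->
  exists2 t : R, 0 < t & a = of_real t.
Proof.
move=> a0; exists (re a); last by rewrite -ge0_of_real // ltW.
by rewrite -ltr_of_real of_real0 -ge0_of_real // ltW.
Qed.

Lemma re_le_norm (a : K) : re a <= re `|a|.
Proof.
case: k a => /= [|a]; first exact: ler_norm.
apply: le_trans (ler_norm _) _.
by have := normc_ge_Re a; rewrite lecE => /andP[].
Qed.

(* [u] is the imaginary unit in the complex case. *)
Lemma norm_le_re : exists u : K, forall a : K,
  re `|a| <= `|re a| + `|re (u * a)|.
Proof.
case: k => /=.
  by exists 0 => a; rewrite lerDl.
(* Since [Re (i a) = - Im a], the claim becomes [|a| <= |Re a| + |Im a|]. *)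
exists 'i%C => a; rewrite [X in X * a]/= mulrC ReiNIm normrN.
rewrite -lecR rmorphD /=.
have -> : (complex.Re `|a|)%:C%C = `|a| by rewrite RRe_real.
rewrite {1}[a]complexE; apply: le_trans (ler_normD _ _) _.
rewrite normrM !normc_def /= !expr0n /= !addr0 !sqrtr_sqr.
by rewrite add0r expr1n sqrtr1 mul1r.
Qed.

End RealScalars.
Arguments re {R k}.
Arguments of_real {R k}.
Arguments ler_of_real {R} k.
Arguments ltr_of_real {R} k.

(** * Ultrafilters on the indices *)

Lemma ultra_bounded_cvg (R : realType) (U : set_system nat) (u : nat -> R)
    (M : R) :
  UltraFilter U -> (forall n, `|u n| <= M) -> exists l : R, u @ U --> l.
Proof.
move=> UU uM.
have UM : (u @ U) [set` `[- M, M]].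
  by apply: nearW => n; rewrite /= in_itv /= -ler_norml.
have [l [_ ul]] := segment_compact (F := u @ U) _ UM.
exists l => A lA.
(* The preimage of [A] or its complement is in [U]; the complement is excluded because [l] is a
   cluster point. *)
have [//|UnA] := in_ultra_setVsetC (u @^-1` A) UU.
by have [r []] := ul (~` A) A UnA lA.
Qed.

(** If [A] were not in [F], then [F] and the complement of [A] would generate a proper filter, and
    an ultrafilter above it would contain both [A] and its complement. *)
Lemma ultra_subset (F : set_system nat) (A : set nat) : Filter F ->
  (forall U : set_system nat, UltraFilter U -> F `<=` U -> U A) -> F A.
Proof.
move=> FF AU; apply: contrapT => nFA.
have WF : ProperFilter (within (~` A) F).
  split; last exact: within_filter.
  by rewrite /within /= => FA; apply: nFA; apply: filterS FA => n /contrapT.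
have [U [UU WU]] := ultraFilterLemma WF.
have UA : U A by apply: AU => B FB; apply: WU; apply: filterS FB.
have UnA : U (~` A) by apply: WU; exact: (nearW (F := F)).
by have [n []] := filter_ex (filterI UA UnA).
Qed.

(** * The underlying real Hilbert space *)

Section RealHilbert.
Context {R : realType} {k : scalar_kind} {H : hilbertSpace R k}.
Implicit Types (x y z : H) (t : R).

Definition rnorm x : R := re `|x|.
Definition rdot x y : R := re (inner H x y).

Lemma rnormE x : `|x| = of_real (rnorm x).
Proof. by rewrite real_of_real. Qed.

Lemma rnorm_ge0 x : 0 <= rnorm x.
Proof. by rewrite -(ler_of_real k) -rnormE of_real0. Qed.

Lemma rnorm0_eq0 x : rnorm x = 0 -> x = 0.
Proof. by move=> x0; apply/normr0_eq0; rewrite rnormE x0 of_real0. Qed.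

Lemma ler_rnormD x y : rnorm (x + y) <= rnorm x + rnorm y.
Proof. by rewrite -(ler_of_real k) of_realD -!rnormE ler_normD. Qed.

Lemma rdotDl x y z : rdot (x + y) z = rdot x z + rdot y z.
Proof. by rewrite /rdot linearDl reD. Qed.

Lemma rdotNl x y : rdot (- x) y = - rdot x y.
Proof. by rewrite /rdot linearNl reN. Qed.

Lemma rdotZl t x y : rdot (of_real t *: x) y = t * rdot x y.
Proof. by rewrite /rdot linearZl_LR /= re_of_realM. Qed.

Lemma rdotC x y : rdot x y = rdot y x.
Proof. by rewrite /rdot hermC /= expr0 mul1r re_conj. Qed.

Lemma rdotDr x y z : rdot z (x + y) = rdot z x + rdot z y.
Proof. by rewrite rdotC rdotDl !(rdotC z). Qed.

Lemma rdotNr x y : rdot y (- x) = - rdot y x.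
Proof. by rewrite rdotC rdotNl (rdotC y). Qed.

Lemma rdotZr t x y : rdot y (of_real t *: x) = t * rdot y x.
Proof. by rewrite rdotC rdotZl (rdotC y). Qed.

Lemma rdotxx x : rdot x x = rnorm x ^+ 2.
Proof.
by rewrite /rdot inner_normE rnormE expr2 -of_realM of_realK.
Qed.

Definition rdotE := (rdotDl, rdotDr, rdotNl, rdotNr, rdotZl, rdotZr).

(* This is the triangle inequality squared. *)
Lemma ler_rdot x y : rdot x y <= rnorm x * rnorm y.
Proof.
have := ler_rnormD x y; have := rdotxx (x + y).
rewrite !rdotE !rdotxx (rdotC y x) => e l.
have := rnorm_ge0 (x + y) => n0.
have : rnorm (x + y) ^+ 2 <= (rnorm x + rnorm y) ^+ 2.
  by rewrite ler_pXn2r ?nnegrE// addr_ge0 ?rnorm_ge0.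
lra.
Qed.

Lemma rnormN x : rnorm (- x) = rnorm x.
Proof. by rewrite /rnorm normrN. Qed.

(** * Completeness and minimisation over closed convex sets *)

Lemma rcauchy_cvg (u : nat -> H) :
  (forall e : R, 0 < e -> exists N : nat, forall m n : nat,
    (N <= m)%N -> (N <= n)%N -> rnorm (u m - u n) < e) ->
  exists l : H, forall e : R, 0 < e -> \forall n \near \oo, rnorm (u n - l) < e.
Proof.
move=> uC.
have /cauchy_cvgP/cvg_ex[l ul] : cauchy (u @ \oo).
  apply: cauchy_exP => _ /gt0_of_real[e e0 ->].
  have [N uN] := uC e e0.
  exists (u N); exists N => // n /= Nn.
  by rewrite -ball_normE /= rnormE ltr_of_real uN.
exists l => e e0.
move/cvgrPdistC_lt : ul => /(_ (of_real e) (of_real_gt0 _ e0)).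
apply: filterS => n.
by rewrite rnormE ltr_of_real.
Qed.

Lemma closed_rlim (C : set H) (u : nat -> H) (l : H) : closed C ->
  (forall n, C (u n)) ->
  (forall e : R, 0 < e -> \forall n \near \oo, rnorm (u n - l) < e) -> C l.
Proof.
move=> Ccl Cu ul; apply: (closed_cvg C Ccl (u_ := u) (F := \oo)).
  exact: nearW.
apply/cvgrPdistC_lt => _ /gt0_of_real[e e0 ->].
by apply: filterS (ul e e0) => n; rewrite rnormE ltr_of_real.
Qed.

(** The segment starts at [x] and has a real parameter, as in the iteration and in variations around
    a minimiser. *)
Definition rconvex (C : set H) := forall x y t,
  C x -> C y -> 0 <= t -> t <= 1 -> C (x + of_real t *: (y - x)).

Lemma convex_set_rconvex (C : set H) : convex_set C -> rconvex C.
Proof.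
move=> Cc x y t Cx Cy t0 t1.
have t0' : 0 <= of_real t :> scalarField R k by rewrite -of_real0 ler_of_real.
have t1' : of_real t <= 1 :> scalarField R k by rewrite -of_real1 ler_of_real.
have := Cc y x (Itv01 t0' t1'); rewrite !inE => /(_ Cy Cx).
congr C; rewrite /conv /= scalerBl scale1r scalerBr [LHS]addrC -addrA.
by congr (_ + _); rewrite addrC.
Qed.

(* [z] minimises [rdot y y - 2 * g y] over [C]: minimising sequences are Cauchy
   by the parallelogram identity. For [g = rdot z0] it is the projection of
   [z0] on [C]; for [C = setT] it represents [g]. *)
Lemma closed_convex_variational (C : set H) (g : H -> R) (B : R) :
  C !=set0 -> closed C -> rconvex C ->
  (forall x y, g (x + y) = g x + g y) ->
  (forall t x, g (of_real t *: x) = t * g x) ->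
  (forall x, g x <= B * rnorm x) ->
  exists2 z, C z & forall y, C y -> g (y - z) <= rdot z (y - z).
Proof.
move=> C0 Ccl Cc gD gZ gB.
have gN x : g (- x) = - g x.
  by rewrite -scaleN1r -(of_real1 (k := k)) -of_realN gZ mulN1r.
pose q y := rdot y y - 2 * g y.
have qB y : - B ^+ 2 <= q y.
  rewrite /q rdotxx; have := gB y; have := sqr_ge0 (rnorm y - B); nra.
have qi : has_inf (q @` C).
  split; first by case: C0 => y Cy; exists (q y), y.
  by exists (- B ^+ 2) => _ [y _ <-].
pose m := inf (q @` C).
have qm y : C y -> m <= q y.
  by move=> Cy; apply: (ge_inf qi.2); exists y.
have [d [d0 small]] : exists d : nat -> R, (forall n, 0 < d n) /\
    forall e : R, 0 < e -> exists N : nat, forall n, (N <= n)%N -> d n < e.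
  exists (fun n => n.+1%:R^-1); split=> [n|e e0]; first by rewrite invr_gt0.
  have := near_infty_natSinv_lt (PosNum e0).
  by move=> [N _ NP]; exists N => n /NP.
have /choice[u uP] (n : nat) : exists y, C y /\ q y < m + d n.
  have [|_ [y Cy <-] yq] := inf_adherent (eps := d n) _ qi; last by exists y.
  exact: d0.
(* [|x - y|^2 = 2 q x + 2 q y - 4 q ((x + y) / 2)], and [q] is at least [m] at the midpoint. *)
have qpar x y : C x -> C y ->
    rnorm (x - y) ^+ 2 <= 2 * (q x - m) + 2 * (q y - m).
  move=> Cx Cy.
  have := qm _ (Cc x y (2^-1) Cx Cy _ _).
  rewrite -rdotxx /q !rdotE gD gZ gD gN (rdotC y x).
  have h0 : 0 <= (2^-1 : R) by lra.
  have h1 : (2^-1 : R) <= 1 by lra.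
  move=> /(_ h0 h1); lra.
have [z uz] : exists l : H,
    forall e : R, 0 < e -> \forall n \near \oo, rnorm (u n - l) < e.
  apply: rcauchy_cvg => e e0.
  (* [qpar] doubles two excesses over [m], each below [e^2 / 4]. *)
  have [|N NP] := small (e ^+ 2 / 4); first by rewrite divr_gt0 ?exprn_gt0.
  exists N => i j Ni Nj.
  rewrite -(@ltr_pXn2r _ 2) ?nnegrE ?rnorm_ge0 ?(ltW e0)//.
  have [[Ci qi'] [Cj qj']] := (uP i, uP j).
  have := qpar _ _ Ci Cj; have := NP _ Ni; have := NP _ Nj; lra.
have Cz : C z by apply: closed_rlim uz => // n; have [] := uP n.
have qz : q z <= m.
  apply/ler_addgt0Pr => e e0.
  (* With [w = u n - z], [q z - q (u n)] is at most [2 (|z| + |B|) |w|]; the summand 1 keeps [D]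
     positive. *)
  pose D := 2 * (rnorm z + `|B|) + 1.
  have D0 : 0 < D by rewrite ltr_wpDl ?mulr_ge0 ?addr_ge0 ?rnorm_ge0.
  have [|N NP] := small (e / 2); first by rewrite divr_gt0.
  have [|M _ MP] := uz (e / (2 * D)); first by rewrite divr_gt0 ?mulr_gt0.
  pose n := maxn N M.
  have nN : d n < e / 2 by apply: NP; rewrite leq_maxl.
  have := MP n (leq_maxr N M); set w := u n - z => /= nM.
  have wD : rnorm w * D < e / 2.
    by move: nM; rewrite invfM mulrA ltr_pdivlMr.
  have [_ qn] := uP n.
  have := ler_rdot z (- w); rewrite rnormN => zw.
  have gw : g w <= `|B| * rnorm w.
    by apply: le_trans (gB w) _; rewrite ler_wpM2r ?rnorm_ge0 ?ler_norm.
  have : q z = q (u n) + 2 * rdot z (- w) - rdot w w + 2 * g w.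
    rewrite /q /w !rdotE gD gN (rdotC (u n) z); ring.
  have : 0 <= rdot w w by rewrite rdotxx sqr_ge0.
  have := rnorm_ge0 w.
  by move: wD; rewrite /D; nra.
exists z => // y Cy; set w := y - z.
rewrite leNgt; apply/negP => lt.
pose c := g w - rdot z w; have c0 : 0 < c by rewrite subr_gt0.
(* Minimality of [z] compared with the point [z + t w] of [C]. *)
have key t : 0 <= t -> t <= 1 -> 2 * t * c <= t ^+ 2 * rdot w w.
  move=> t0 t1; have := qm _ (Cc z y t Cz Cy t0 t1); rewrite -/w; clearbody w.
  move: qz; rewrite /q /c !rdotE gD gZ (rdotC w z); lra.
have ww0 : 0 <= rdot w w by rewrite rdotxx sqr_ge0.
(* [t = c / s] lies in [(0, 1]] and gives [t^2 |w|^2 <= t^2 s = t c < 2 t c], against [key]. *)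
pose s := c + rdot w w.
have s0 : 0 < s by rewrite /s; lra.
have ts : c / s * s = c by rewrite divfK // gt_eqF.
have t0 : 0 < c / s by rewrite divr_gt0.
have t1 : c / s <= 1 by rewrite ler_pdivrMr// mul1r /s; lra.
have := key _ (ltW t0) t1; move: (c / s) ts t0 => t ts t0.
have : t ^+ 2 * s = t * c by rewrite expr2 -mulrA ts.
have := mulr_gt0 t0 c0; have := sqr_ge0 t.
rewrite /s; nra.
Qed.

(** * Riesz representation and weak limits along a filter *)

Lemma riesz (g : H -> R) (B : R) :
  (forall x y, g (x + y) = g x + g y) ->
  (forall t x, g (of_real t *: x) = t * g x) ->
  (forall x, g x <= B * rnorm x) ->
  exists z, forall y, g y = rdot z y.
Proof.
move=> gD gZ gB.
have C0 : [set: H] !=set0 by exists 0.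
have [//|z _ zP] := @closed_convex_variational setT g B C0 closedT _ gD gZ gB.
(* On the whole space [y - z] is arbitrary; the bound at [- y] then gives the reverse inequality. *)
have le y : g y <= rdot z y by have := zP (y + z) I; rewrite addrK.
exists z => y; apply/le_anti; rewrite le /=.
have := le (- y); rewrite rdotNr.
by rewrite -scaleN1r -of_real1 -of_realN gZ mulN1r lerN2.
Qed.

(* Convergence is along an arbitrary filter on the indices, which will be an
   ultrafilter, so that no subsequence has to be extracted. *)
Definition weak_rlim (U : set_system nat) (x : nat -> H) (z : H) :=
  forall h, (fun n => rdot (x n) h) @ U --> rdot z h.

(** Let [w] be the projection of [z] on [C]. The inequality [<z - w, x n - w> <= 0] passes to the
    weak limit and becomes [|z - w|^2 <= 0]. *)
Lemma weak_rlim_closed (U : set_system nat) (C : set H) (x : nat -> H) (z : H) :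
  ProperFilter U -> closed C -> rconvex C -> (forall n, C (x n)) ->
  weak_rlim U x z -> C z.
Proof.
move=> UF Ccl Cc Cx xz.
have C0 : C !=set0 by exists (x 0%N).
have [|||w Cw wP] := @closed_convex_variational C (rdot z) (rnorm z) C0 Ccl Cc.
- by move=> *; rewrite rdotDr.
- by move=> *; rewrite rdotZr.
- by move=> *; exact: ler_rdot.
suff : rnorm (z - w) <= 0.
  move=> zw0; suff /subr0_eq -> : z - w = 0 by [].
  by apply/rnorm0_eq0/le_anti; rewrite zw0 rnorm_ge0.
rewrite -(@ler_pXn2r _ 2) ?nnegrE ?rnorm_ge0// expr0n /= -rdotxx.
have : rdot z (z - w) <= rdot (z - w) w.
  apply: (cvgr_to_le (xz (z - w))); apply: nearW => n.
  have := wP _ (Cx n); rewrite !rdotE !(rdotC (x n)); lra.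
rewrite !rdotE (rdotC w z); lra.
Qed.

(** One ultrafilter serves all [h] at once; the limit is real-linear in [h] and bounded by [M |h|],
    so Riesz applies. *)
Lemma weak_rlim_ultra (U : set_system nat) (x : nat -> H) (M : R) :
  UltraFilter U -> (forall n, rnorm (x n) <= M) -> exists z, weak_rlim U x z.
Proof.
move=> UU xM.
have /choice[phi phiP] (h : H) :
    exists l : R, (fun n => rdot (x n) h) @ U --> l.
  apply: (@ultra_bounded_cvg _ _ _ (M * rnorm h)) => n.
  rewrite ler_norml lerNl -rdotNr -{1}(rnormN h).
  by rewrite !(le_trans (ler_rdot _ _)) // ler_wpM2r ?rnorm_ge0.
have [|||z zP] := @riesz phi M.
- move=> h h'; apply: (cvg_unique _ (phiP (h + h'))) => //.
  have -> : (fun n => rdot (x n) (h + h')) =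
      (fun n => rdot (x n) h + rdot (x n) h').
    by apply/funext => n; rewrite rdotDr.
  exact: cvgD.
- move=> t h; apply: (cvg_unique _ (phiP (of_real t *: h))) => //.
  have -> : (fun n => rdot (x n) (of_real t *: h)) =
      (fun n => t * rdot (x n) h).
    by apply/funext => n; rewrite rdotZr.
  exact: cvgMr.
- move=> h; apply: (cvgr_to_le (phiP h)); apply: nearW => n.
  by apply: le_trans (ler_rdot _ _) _; rewrite ler_wpM2r ?rnorm_ge0.
by exists z => h; rewrite -zP.
Qed.

(** * Krasnoselskii iteration of a nonexpansive map *)

Section Krasnoselskii.
Context (C : set H) (T : H -> H) (M : R).
Hypotheses (Ccl : closed C) (Cc : rconvex C).
Hypothesis CM : forall x, C x -> rnorm x <= M.
Hypothesis TC : forall x, C x -> C (T x).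
Hypothesis Tne : forall x y, C x -> C y -> rnorm (T x - T y) <= rnorm (x - y).

(** With [v = x n - z] and [w = T z - z], squaring [|v - w| <= d n + |v|] bounds [|w|^2] by
    [2 <v, w> + d n^2 + 2 |v| d n], which tends to 0 since [|v| <= 2 M]. *)
Lemma demiclosed (U : set_system nat) (x : nat -> H) (z : H) :
  ProperFilter U -> (forall n, C (x n)) -> weak_rlim U x z ->
  (fun n => rnorm (x n - T (x n))) @ U --> 0 -> T z = z.
Proof.
move=> UF Cx xz d0.
have Cz : C z by exact: weak_rlim_closed xz.
pose w := T z - z; pose d n := rnorm (x n - T (x n)).
have dle n : rdot w w <=
    2 * (rdot (x n) w - rdot z w) + (d n * d n + 2 * (2 * M) * d n).
  have vM : rnorm (x n - z) <= 2 * M.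
    apply: le_trans (ler_rnormD _ _) _.
    by rewrite rnormN mulr_natl mulr2n lerD ?CM.
  have dn0 : 0 <= d n by exact: rnorm_ge0.
  have : rnorm (x n - T z) <= d n + rnorm (x n - z).
    rewrite -(subrKA (T (x n))); apply: le_trans (ler_rnormD _ _) _.
    by rewrite lerD2l Tne.
  rewrite -(@ler_pXn2r _ 2) ?nnegrE ?addr_ge0 ?rnorm_ge0//.
  have -> : x n - T z = (x n - z) - w by rewrite /w opprB addrA subrK.
  have -> : rdot (x n) w - rdot z w = rdot (x n - z) w by rewrite rdotDl rdotNl.
  have := rnorm_ge0 (x n - z); move: vM; move: (x n - z) => v vM v0.
  rewrite -rdotxx; clearbody w; rewrite !rdotE (rdotC w v) (rdotxx v).
  nra.
suff : rdot w w <= 0.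
  move=> w0; apply/subr0_eq/rnorm0_eq0/eqP.
  by rewrite -sqrf_eq0 -rdotxx -/w eq_le w0 rdotxx sqr_ge0.
(* Zero is written as the bound of [dle] with each term replaced by its limit. *)
have -> : 0 = 2 * (rdot z w - rdot z w) + (0 * 0 + 2 * (2 * M) * 0) :> R.
  by ring.
apply: (@cvgr_to_ge _ U _ _ (fun n =>
  2 * (rdot (x n) w - rdot z w) + (d n * d n + 2 * (2 * M) * d n))).
2: exact: nearW.
apply: cvgD; first by apply: cvgMr; apply: cvgB; [exact: xz | exact: cvg_cst].
by apply: cvgD; [apply: cvgM | apply: cvgMr].
Qed.

Context (p : H) (l : R) (x : nat -> H).
Hypotheses (Cp : C p) (Tp : T p = p) (l0 : 0 < l) (l1 : l < 1).
Hypotheses (Cx0 : C (x 0%N)).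
Hypothesis xS : forall n, x n.+1 = x n + of_real l *: (T (x n) - x n).

Lemma krasnoselskii_stays n : C (x n).
Proof.
by elim: n => // n Cn; rewrite xS; apply: Cc; rewrite ?ltW //; exact: TC.
Qed.

Lemma asymptotic_regularity : (fun n => rnorm (x n - T (x n))) @ \oo --> 0.
Proof.
pose a n := rdot (x n - p) (x n - p); pose d n := rnorm (x n - T (x n)).
have aS n : l * (1 - l) * d n ^+ 2 <= a n - a n.+1.
  have Cn := krasnoselskii_stays n.
  have := Tne _ _ Cn Cp; rewrite Tp -(@ler_pXn2r _ 2) ?nnegrE ?rnorm_ge0//.
  rewrite /a /d -!rdotxx xS.
  have -> : x n + of_real l *: (T (x n) - x n) - p =
      (x n - p) + of_real l *: ((T (x n) - p) - (x n - p)).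
    by rewrite opprB addrA subrK addrAC.
  have -> : x n - T (x n) = (x n - p) - (T (x n) - p).
    by rewrite opprB addrA subrK.
  (* The decrease [a n - a n.+1] equals [l (|v|^2 - |w|^2) + l (1 - l) |v - w|^2], whose first term
     is nonnegative. *)
  move: (x n - p) (T (x n) - p) => v w.
  rewrite !rdotE (rdotC w v) -subr_ge0 => /(mulr_ge0 (ltW l0)).
  lra.
have ll : 0 < l * (1 - l) by rewrite mulr_gt0 ?subr_gt0.
have acv : cvgn a.
  apply: nonincreasing_is_cvgn.
    apply/nonincreasing_seqP => n; rewrite -subr_ge0; apply: le_trans (aS n).
    by rewrite mulr_ge0 ?sqr_ge0// ltW.
  by exists 0 => _ [n _ <-]; rewrite /a rdotxx sqr_ge0.
(* Consecutive terms of the convergent sequence [a] have the same limit. *)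
have ad : (fun n => a n - a n.+1) @ \oo --> 0.
  rewrite -(subrr (limn a)); apply: cvgB => //.
  by rewrite cvg_shiftS.
apply/cvgr0Pnorm_lt => e e0.
have le0 : 0 < l * (1 - l) * e ^+ 2 by rewrite mulr_gt0 ?exprn_gt0.
move/cvgr0Pnorm_lt : ad => /(_ _ le0); apply: filterS => n /ltr_normlW an.
rewrite ger0_norm ?rnorm_ge0// -(@ltr_pXn2r _ 2) ?nnegrE ?rnorm_ge0 ?(ltW e0)//.
by rewrite -(ltr_pM2l ll); exact: le_lt_trans (aS n) an.
Qed.

Lemma krasnoselskii_ultra (U : set_system nat) :
  (forall q, C q -> T q = q -> q = p) ->
  UltraFilter U -> \oo `<=` U -> weak_rlim U x p.
Proof.
move=> pP UU Uoo.
have [z xz] := @weak_rlim_ultra U x M UU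
  (fun n => CM _ (krasnoselskii_stays n)).
suff <- : z = p by [].
apply: pP; first exact: weak_rlim_closed krasnoselskii_stays xz.
apply: demiclosed krasnoselskii_stays xz _ => // A /asymptotic_regularity.
exact: Uoo.
Qed.

End Krasnoselskii.

(** * Continuous functionals and weak convergence of the iterates *)

Lemma continuous_linear_rdot (f : {linear H -> (scalarField R k)^o}) :
  continuous f -> exists h, forall y, re (f y) = rdot h y.
Proof.
move=> /(_ 0)/(continuous_linear_bounded 0)/linear_boundedP[N [Nr fN]].
(* The bound holds for constants strictly above [N], hence the added 1. *)
have {}fN := fN (N + 1) ltac:(by rewrite ltrDl).
have N1r : N + 1 \is Num.real by rewrite realD.
apply: (@riesz _ (re (N + 1))).
- by move=> y z; rewrite linearD reD.
- by move=> t y; rewrite linearZ /= re_of_realM.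
- move=> y; apply: le_trans (re_le_norm _) _.
  rewrite -(ler_of_real k) real_of_real ?normr_real// of_realM -rnormE.
  by rewrite real_of_real.
Qed.

End RealHilbert.

Theorem theorem5 (R : realType) (k : scalar_kind) (H : hilbertSpace R k)
    (C : set H) (F : H -> H -> H) (p : H) :
  C !=set0 -> closed C -> bounded_set C -> convex_set C ->
  (forall x y : H, C x -> C y -> C (F x y)) ->
  weakly_nonexpansive C F ->
  C p ->
  [set q | C q /\ F q q = q] = [set p] ->
  forall (lambda : scalarField R k) (x0 : H), 0 < lambda < 1 -> C x0 ->
  forall x : nat -> H,
    x 0%N = x0 ->
    (forall n : nat, x n.+1 = (1 - lambda) *: x n + lambda *: F (x n) (x n)) ->
    weak_cvg x p.
Proof.
move=> _ Ccl [N [Nr CN]] /convex_set_rconvex Cc FC.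
move=> [a [b [a0 b0 ab1 Fab]]] Cp Fp.
move=> lambda x0 /andP[l0 l1] Cx0 x xx0 xS.
pose T y := F y y; pose M := re (N + 1).
have CM y : C y -> rnorm y <= M.
  move=> Cy; rewrite -(ler_of_real k) -rnormE real_of_real ?realD//.
  by apply: CN; rewrite // ltrDl.
have TC y : C y -> C (T y) by move=> Cy; exact: FC.
(* On the diagonal both differences are [y - z], so the constant is [a + b <= 1]. *)
have Tne y z : C y -> C z -> rnorm (T y - T z) <= rnorm (y - z).
  move=> Cy Cz; rewrite -(ler_of_real k) -!rnormE.
  apply: le_trans (Fab _ _ _ _ Cy Cy Cz Cz) _.
  by rewrite -mulrDl ler_piMl.
have Tp : T p = p.
  by have : [set q | C q /\ F q q = q] p by [rewrite Fp]; case.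
have pP q : C q -> T q = q -> q = p.
  by move=> Cq Tq; have : [set q | C q /\ F q q = q] q by []; rewrite Fp.
have [l l0' le] := gt0_of_real lambda l0.
have l1' : l < 1 by rewrite -(ltr_of_real k) -le of_real1.
have xS' n : x n.+1 = x n + of_real l *: (T (x n) - x n).
  by rewrite xS le scalerBl scale1r scalerBr -!addrA [- _ + _]addrC.
have xp (U : set_system nat) : UltraFilter U -> \oo `<=` U -> weak_rlim U x p.
  by apply: (@krasnoselskii_ultra _ _ _ C T M Ccl Cc CM TC Tne p l x) => //;
    rewrite xx0.
have re_cvg (g : {linear H -> (scalarField R k)^o}) (U : set_system nat) :
    UltraFilter U -> \oo `<=` U -> continuous g ->
    (fun n => re (g (x n - p))) @ U --> 0.
  move=> UU Uoo /continuous_linear_rdot[h hP].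
  have -> : (fun n => re (g (x n - p))) = (fun n => rdot (x n) h - rdot p h).
    by apply/funext => n; rewrite hP rdotC rdotDl rdotNl.
  rewrite -(subrr (rdot p h)); apply: cvgB; last exact: cvg_cst.
  exact: xp.
move=> f fc; apply/cvgrPdistC_lt => _ /gt0_of_real[e e0 ->].
apply: ultra_subset => U UU Uoo.
(* The modulus of [f (x n - p)] is controlled by the real parts of [f] and of [u f], each below
   [e / 2] along [U]. *)
have [u uP] := @norm_le_re R k.
pose uf : {linear H -> (scalarField R k)^o} := u \*: f.
have ufc : continuous uf by move=> y; apply: cvgZr; exact: fc.
have e2 : 0 < e / 2 by rewrite divr_gt0.
move/cvgr0Pnorm_lt : (re_cvg f U UU Uoo fc) => /(_ _ e2) near1.
move/cvgr0Pnorm_lt : (re_cvg uf U UU Uoo ufc) => /(_ _ e2).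
apply: filterS2 near1 => n fn ufn.
rewrite -linearB (ge0_of_real _ (normr_ge0 (f (x n - p)))) ltr_of_real.
apply: le_lt_trans (uP _) _.
by rewrite (splitr e) ltrD.
Qed.
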